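(* Let $n,k\ge 1$ be integers. The set of chained permutations $P^{-}_{n,k}$ is in bijection with the set of perfect matchings of $G^{-}_{n,k}$ if $k$ is odd, and with the set of matchings of $G^{-}_{n,k}$ that leave exactly $n$ vertices unmatched if $k$ is even. The set of chained permutations $P^{\circ}_{n,k}$ is in bijection with the set of perfect matchings of $G^{\circ}_{n,k}$ if at least one of $n$ or $k$ is even, and with the set of near-perfect matchings of $G^{\circ}_{n,k}$ if $n$ and $k$ are both odd.
   Context: The sets $P^{-}_{n,k}$ and $P^{\circ}_{n,k}$ of chained linear and circular permutation matrices (chained permutations) consist of the $k$-tuples $(X^{(1)},\dots,X^{(k)})$ of $n\times n$ matrices with entries in $\{0,1\}$ such that: (a) $\sum_{j=1}^n X^{(\ell-1)}_{i,j}+\sum_{j=1}^n X^{(\ell)}_{j,i}\in\{0,1\}$ for all $1\le i\le n$ and $1\le\ell\le k$, where $X^{(0)}=X^{(k)}$ in the circular case and $X^{(0)}$ is the zero matrix in the linear case; in the linear case one also requires that each row sum of $X^{(k)}$ lies in $\{0,1\}$; (b) the sum of all entries $\sum_{i,j,\ell}X^{(\ell)}_{i,j}$ is maximum among all $k$-tuples satisfying (a). The graph $G^{-}_{n,k}$ has labelled vertices arranged in rows $0,1,\dots,k$ with $n$ vertices in each row; for each $1\le i\le k$, every vertex of row $i-1$ is joined to every vertex of row $i$ by one edge (forming $K_{n,n}$), and there are no other edges. $G^{\circ}_{n,k}$ is obtained from $G^{-}_{n,k}$ by identifying, for each $j$, the $j$th vertex of row $0$ with the $j$th vertex of row $k$.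 All edges are kept in this identification, so $G^{\circ}_{n,k}$ is a multigraph (with distinguishable parallel edges when $k=1,2$, and loops when $k=1$). A matching is a set of edges no two of which share a vertex, and containing no loops. A perfect matching is a matching for which every vertex is incident to exactly one edge of the matching. A near-perfect matching of a graph with an odd number of vertices is a matching such that every vertex except exactly one is incident to an edge of the matching. *)

(* Defs.v *)
From HB Require Import structures.
From mathcomp Require Import all_boot all_algebra.

Set Implicit Arguments.
Unset Strict Implicit.
Unset Printing Implicit Defensive.

Definition in_bijection (T U : finType) (A : {set T}) (B : {set U}) : Prop :=
  exists f : {x | x \in A} -> {y | y \in B}, bijective f.

Section ChainedPermutations.

Variables n k : nat.

(* A {0,1}-matrix is a boolean matrix; its entries coerce to nat in sums. *)
Notation chain := (k.-tuple 'M[bool]_n).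
Implicit Types (X Y : chain) (A : 'M[bool]_n).

Definition row_sum A (i : 'I_n) : nat := \sum_(j < n) A i j.
Definition col_sum A (i : 'I_n) : nat := \sum_(j < n) A j i.

Definition zero_mx : 'M[bool]_n := const_mx false.

Definition last_mx X : 'M[bool]_n := last zero_mx X.

(* With X0 in the role of X^(0), the entry of index l of X0 :: X is X^(l) for
   0 <= l <= k; the condition relates X^(l) to X^(l+1) for 0 <= l < k. *)
Definition chain_condition (X0 : 'M[bool]_n) X : bool :=
  [forall l : 'I_k, forall i : 'I_n,
     row_sum (nth zero_mx (X0 :: X) l) i
       + col_sum (nth zero_mx (X0 :: X) l.+1) i \in [:: 0; 1]].

Definition linear_condition X : bool :=
  chain_condition zero_mx X
    && [forall i : 'I_n, row_sum (last_mx X) i \in [:: 0; 1]].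

Definition circular_condition X : bool := chain_condition (last_mx X) X.

Definition entry_sum X : nat :=
  \sum_(l < k) \sum_(i < n) \sum_(j < n) tnth X l i j.

Definition maximizers (cond : pred chain) : {set chain} :=
  [set X | cond X & [forall Y : chain, cond Y ==> (entry_sum Y <= entry_sum X)]].

Definition linear_chained_perms : {set chain} := maximizers linear_condition.

Definition circular_chained_perms : {set chain} :=
  maximizers circular_condition.

End ChainedPermutations.

(* Undirected multigraphs, possibly with loops: the two ends of an edge are
   listed in an order that none of the notions below depends on. *)
Record multigraph := Multigraph {
  vertex : finType;
  edge : finType;
  ends : edge -> vertex * vertex }.

Section Matchings.

Variable G : multigraph.
Implicit Types (v : vertex G) (e : edge G) (M : {set edge G}).

Definition incident v e : bool := (v == (ends e).1) || (v == (ends e).2).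

Definition is_loop e : bool := (ends e).1 == (ends e).2.

Definition matching M : bool :=
  [forall e in M, ~~ is_loop e] &&
  [forall e in M, forall f in M,
     (e != f) ==> ~~ [exists v, incident v e && incident v f]].

Definition unmatched M : {set vertex G} :=
  [set v | ~~ [exists e in M, incident v e]].

Definition perfect_matchings : {set {set edge G}} :=
  [set M | matching M & [forall v, #|[set e in M | incident v e]| == 1]].

Definition matchings_leaving (m : nat) : {set {set edge G}} :=
  [set M | matching M & #|unmatched M| == m].

(* A graph having such a matching has an odd number of vertices. *)
Definition near_perfect_matchings : {set {set edge G}} := matchings_leaving 1.

End Matchings.

(* The vertex map h identifies vertices with equal images; every edge is kept. *)
Definition identify (G : multigraph) (W : finType) (h : vertex G -> W) :
    multigraph :=
  Multigraph (fun e : edge G => (h (ends e).1, h (ends e).2)).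

(* The vertex (r, a) is the a-th vertex of row r; the edge (i, (a, b)) joins
   the a-th vertex of row i to the b-th vertex of row i + 1. *)
Definition linear_graph (n k : nat) : multigraph :=
  @Multigraph ('I_k.+1 * 'I_n)%type ('I_k * ('I_n * 'I_n))%type
    (fun e => let: (i, (a, b)) := e in
       ((widen_ord (leqnSn k) i, a), (lift ord0 i, b))).

(* Row k is sent to row 0, and every other row to itself. *)
Definition circular_graph (n k : nat) (hk : 0 < k) : multigraph :=
  @identify (linear_graph n k) ('I_k * 'I_n)%type
    (fun v => (Ordinal (ltn_pmod v.1 hk), v.2)).

(* Main.v *)
Require Import Defs.
From mathcomp Require Import all_boot all_algebra.
From mathcomp Require Import zify.

Set Implicit Arguments.
Unset Strict Implicit.
Unset Printing Implicit Defensive.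

(** A k-tuple of 0-1 matrices is the same thing as a set of edges of the layered
    graph: the entry (b, a) of X^(l+1) says whether the edge from the a-th
    vertex of row l to the b-th vertex of row l + 1 is chosen ([arc_set]).
    Under this dictionary the two sums in condition (a) count the chosen edges
    that reach a vertex from the row below and from the row above, so together
    they are its degree, and (a) says that every degree is at most 1.  Counting
    a loop twice in the degree makes this equivalent to being a matching also
    for k = 1 ([matching_degreeP]).  Since the sum of the entries is the number
    of chosen edges, the chained permutations are exactly the matchings of
    maximum cardinality, on both graphs ([linear_conditionE],
    [circular_conditionE]).

    A matching M satisfies 2 |M| + #unmatched = #vertices ([matching_count]),
    so the maximum matchings are those leaving m vertices unmatched as soon as
    m is a lower bound that some matching attains
    ([maximizers_in_bijection]).  It remains to find m.

    - Linear graph.  The vertical edges leaving the even rows miss nothing if k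
      is odd, and only row k if k is even.  In the latter case nothing better
      is possible: the n k / 2 vertices of the odd rows meet every edge, hence
      bound the size of every matching ([linear_unmatched_ge]).
    - Circular graph.  The number of unmatched vertices has the parity of n k,
      so it is at least 1 when n and k are odd.  This bound is attained by
      [snake_matching]: for even k by vertical edges as above, for odd k by
      joining the columns 2c and 2c + 1, which are odd cycles, through one edge
      and covering the rest of both by vertical edges; for odd n, one vertex
      of the last column stays unmatched. *)

(** * Bijections between subsets *)

Lemma in_bijection_preim (T U : finType) (A : {set T}) (B : {set U})
    (f : T -> U) :
  bijective f -> (forall x, (f x \in B) = (x \in A)) -> in_bijection A B.
Proof.
move=> [g fK gK] memf.
have memg y : y \in B -> g y \in A by rewrite -memf gK.
have memf' x : x \in A -> f x \in B by rewrite memf.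
exists (fun x => exist _ (f (val x)) (memf' _ (valP x))).
exists (fun y => exist _ (g (val y)) (memg _ (valP y))).
  by move=> x; apply: val_inj; rewrite /= fK.
by move=> y; apply: val_inj; rewrite /= gK.
Qed.

(** * Matchings and degrees *)

Section Degree.

Variable G : multigraph.
Implicit Types (M N : {set edge G}) (v : vertex G) (e : edge G).

(** A loop contributes to both sums, hence twice. *)
Definition degree M v : nat :=
  \sum_(e in M) (v == (ends e).1) + \sum_(e in M) (v == (ends e).2).

Lemma degreeE M v :
  degree M v = \sum_(e in M) ((v == (ends e).1) + (v == (ends e).2)).
Proof. by rewrite big_split. Qed.

Lemma degree_eq0 M v : (degree M v == 0) = (v \in unmatched M).
Proof.
rewrite degreeE sum_nat_eq0 inE negb_exists; apply: eq_forallb => e.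
by rewrite addn_eq0 !eqb0 negb_and /incident negb_or implybE.
Qed.

(** A loop alone already has degree 2 at its vertex, so the degree bound
    excludes loops together with adjacent edges. *)
Lemma matching_degreeP M :
  reflect (forall v, degree M v <= 1) (matching M).
Proof.
apply: (iffP andP) => [[/forall_inP noloop /forall_inP disj] v | deg1].
  case: (pickP [pred e in M | incident v e]) => [e /andP[/= eM ve] | none].
    have only f : (f \in M) && (f != e) ->
        (v == (ends f).1) + (v == (ends f).2) = 0.
      case/andP=> fM nfe; have /forall_inP/(_ f fM) := disj e eM.
      rewrite eq_sym nfe negb_exists => /forallP/(_ v).
      by rewrite ve /= /incident; do 2 case: eqP.
    rewrite degreeE (bigD1 e) //= big1 // addn0.
    have := noloop e eM; rewrite /is_loop.
    by case: (v =P (ends e).1) => [<-|_]; case: (v == (ends e).2).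
  suff /eqP-> : degree M v == 0 by [].
  rewrite degree_eq0 inE negb_exists; apply/forallP => e.
  by have := none e; rewrite /= => ->.
split; apply/forall_inP => e eM.
  apply/negP => /eqP loop_e; have := deg1 (ends e).1.
  by rewrite degreeE (bigD1 e) //= -loop_e eqxx.
apply/forall_inP => f fM; apply/implyP => nef.
apply/negP => /existsP[v /andP[ve vf]]; have := deg1 v.
rewrite degreeE (bigD1 e) //= (bigD1 f) /=; last by rewrite fM eq_sym.
by move: ve vf; rewrite /incident; lia.
Qed.

Lemma sum_degree M : \sum_v degree M v = #|M|.*2.
Proof.
rewrite big_split /= exchange_big [X in _ + X]exchange_big -addnn /=.
have one (w : edge G -> vertex G) : \sum_(e in M) \sum_v (v == w e) = #|M|.
  rewrite -sum1_card; apply: eq_bigr => e _.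
  by rewrite (bigD1 (w e)) //= eqxx big1 // => v /negPf->.
by rewrite !one.
Qed.

(** In a matching, each vertex adds 1 to the degree sum if it is matched and 1
    to the number of unmatched vertices otherwise. *)
Lemma matching_count M :
  matching M -> #|M|.*2 + #|unmatched M| = #|vertex G|.
Proof.
move/matching_degreeP => deg1.
rewrite -sum_degree -!sum1_card [X in _ + X]big_mkcond -big_split.
apply: eq_bigr => v _; rewrite -degree_eq0.
by have := deg1 v; case: degree => [|[]].
Qed.

Lemma odd_unmatched M :
  matching M -> odd #|unmatched M| = odd #|vertex G|.
Proof. by move/matching_count <-; rewrite oddD odd_double. Qed.

(** The easy half of Koenig's theorem: each edge of M is charged to one of its
    ends in C, and no vertex is charged twice. *)
Lemma matching_le_cover M (C : {set vertex G}) :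
  (forall e, ((ends e).1 \in C) || ((ends e).2 \in C)) ->
  matching M -> #|M| <= #|C|.
Proof.
move=> cover /matching_degreeP deg1.
rewrite -[#|C|]sum1_card; apply: (@leq_trans (\sum_(v in C) degree M v)).
  under eq_bigr => v _ do rewrite degreeE.
  rewrite exchange_big -sum1_card; apply: leq_sum => e _ /=.
  by case/orP: (cover e) => endC; rewrite (bigD1 _ endC) /= eqxx /=; lia.
by apply: leq_sum.
Qed.

Lemma perfect_matchingsE : perfect_matchings G = matchings_leaving G 0.
Proof.
apply/setP => M; rewrite !inE; have [mM /=|//] := boolP (matching M).
rewrite cards_eq0; apply/forallP/eqP => [one | all_matched v].
  apply/setP => v; rewrite !inE; apply/negbF/existsP.
  have /card_gt0P[e] : 0 < #|[set e in M | incident v e]|.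
    by rewrite (eqP (one v)).
  by rewrite inE; exists e.
have : v \notin unmatched M by rewrite all_matched inE.
rewrite inE negbK => /existsP[e /andP[eM ve]].
apply/cards1P; exists e; apply/setP => f; rewrite !inE.
apply/andP/eqP => [[fM vf] | ->//]; apply/eqP; apply: contraTT vf => nfe.
have /andP[_ /forall_inP/(_ e eM)/forall_inP/(_ f fM)] := mM.
by rewrite eq_sym nfe negb_exists => /forallP/(_ v); rewrite ve.
Qed.

End Degree.

(** * Chains of matrices as edge sets *)

Section Encoding.

Variables n k : nat.
Notation chain := (k.-tuple 'M[bool]_n).
Notation arc := ('I_k * ('I_n * 'I_n))%type.
Implicit Types (X : chain) (A : 'M[bool]_n).

(** The transposition matches condition (a), where the column sums of X^(l+1)
    belong to row l of the graph and its row sums to row l + 1. *)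
Definition arc_set X : {set arc} := [set e | tnth X e.1 e.2.2 e.2.1].

Lemma arc_set_bij : bijective arc_set.
Proof.
exists (fun M : {set arc} =>
  [tuple (\matrix_(b < n, a < n) ((i, (a, b)) \in M))%R | i < k]).
  move=> X; apply: eq_from_tnth => i; rewrite tnth_mktuple.
  by apply/matrixP => b a; rewrite mxE inE.
by move=> M; apply/setP => [[i [a b]]]; rewrite inE tnth_mktuple mxE.
Qed.

Lemma sum_arc_set X (F : arc -> nat) :
  \sum_(e in arc_set X) F e =
  \sum_(i < k) \sum_(a < n) \sum_(b < n) tnth X i b a * F (i, (a, b)).
Proof.
pose H i (p : 'I_n * 'I_n) := tnth X i p.2 p.1 * F (i, p).
transitivity (\sum_i \sum_p H i p); last first.
  by apply: eq_bigr => i _; rewrite pair_bigA; apply: eq_bigr => [[a b] _].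
rewrite pair_bigA big_mkcond; apply: eq_bigr => [[i [a b]] _].
by rewrite inE /H /=; case: (tnth X i b a); rewrite ?mul1n ?mul0n.
Qed.

Lemma card_arc_set X : #|arc_set X| = entry_sum X.
Proof.
rewrite -sum1_card sum_arc_set; apply: eq_bigr => i _; rewrite exchange_big.
by apply: eq_bigr => b _; apply: eq_bigr => a _; rewrite muln1.
Qed.

Lemma sum_arc_tails X (p : pred 'I_k) a :
  \sum_(e in arc_set X) (p e.1 && (a == e.2.1)) =
  \sum_(i < k | p i) col_sum (tnth X i) a.
Proof.
rewrite sum_arc_set [RHS]big_mkcond; apply: eq_bigr => i _ /=.
case: (p i) => /=; last first.
  by rewrite big1 // => b _; rewrite big1 // => c _; rewrite muln0.
rewrite (bigD1 a) //= [X in _ + X]big1 ?addn0.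
  by apply: eq_bigr => b _; rewrite eqxx muln1.
by move=> c nca; rewrite big1 // => b _; rewrite eq_sym (negPf nca) muln0.
Qed.

Lemma sum_arc_heads X (p : pred 'I_k) b :
  \sum_(e in arc_set X) (p e.1 && (b == e.2.2)) =
  \sum_(i < k | p i) row_sum (tnth X i) b.
Proof.
rewrite sum_arc_set [RHS]big_mkcond; apply: eq_bigr => i _ /=.
rewrite exchange_big /=; case: (p i) => /=; last first.
  by rewrite big1 // => a _; rewrite big1 // => c _; rewrite muln0.
rewrite (bigD1 b) //= [X in _ + X]big1 ?addn0.
  by apply: eq_bigr => a _; rewrite eqxx muln1.
by move=> c ncb; rewrite big1 // => a _; rewrite eq_sym (negPf ncb) muln0.
Qed.

Lemma row_sum0 a : row_sum (zero_mx n) a = 0.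
Proof. by rewrite /row_sum big1 // => j _; rewrite mxE. Qed.

Lemma col_sum0 a : col_sum (zero_mx n) a = 0.
Proof. by rewrite /col_sum big1 // => j _; rewrite mxE. Qed.

(** For r >= k the sum is empty and the default of [nth] is the zero matrix, so
    the last row of the linear graph obeys the same formula as the others. *)
Lemma sum_pred1_nth X (f : 'M[bool]_n -> nat) (r : nat) :
  f (zero_mx n) = 0 ->
  \sum_(i < k | r == i :> nat) f (tnth X i) = f (nth (zero_mx n) X r).
Proof.
move=> f0; case: (ltnP r k) => [ltrk | lekr].
  by rewrite (big_pred1 (Ordinal ltrk)) ?(tnth_nth (zero_mx n)) //.
rewrite nth_default ?size_tuple // big_pred0 // => i.
by apply/negbTE; have := ltn_ord i; lia.
Qed.

(** In the first term, the zero matrix put in front accounts for row 0, which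
    has no edges from below; in the second, the default of [nth] accounts for
    row k. *)
Lemma degree_linear X (v : vertex (linear_graph n k)) :
  @degree (linear_graph n k) (arc_set X) v =
  row_sum (nth (zero_mx n) (zero_mx n :: X) v.1) v.2
    + col_sum (nth (zero_mx n) X v.1) v.2.
Proof.
case: v => r a /=; rewrite /degree addnC; congr (_ + _).
  transitivity (\sum_(i < k | val r == i.+1) row_sum (tnth X i) a).
    rewrite -sum_arc_heads; apply: eq_bigr => [[i [c d]] _] /=.
    by rewrite xpair_eqE -val_eqE.
  case: r => [[|r'] ltr] /=; first by rewrite row_sum0 big1.
  by rewrite -(@sum_pred1_nth _ (fun A => row_sum A a) _ (row_sum0 a)).
rewrite -(@sum_pred1_nth _ (fun A => col_sum A a) _ (col_sum0 a)).
rewrite -sum_arc_tails.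
by apply: eq_bigr => [[i [c d]] _] /=; rewrite xpair_eqE -val_eqE.
Qed.

Lemma mem01 m : (m \in [:: 0; 1]) = (m <= 1).
Proof. by case: m => [|[]]. Qed.

Lemma linear_conditionE X :
  linear_condition X = @matching (linear_graph n k) (arc_set X).
Proof.
apply/andP/matching_degreeP =>
  [[/forallP chain_ok /forallP last_ok] [r a] | deg1].
  rewrite degree_linear /=; case: (ltnP r k) => [ltrk | lekr].
    by have /forallP/(_ a) := chain_ok (Ordinal ltrk); rewrite mem01.
  have rk : r = k :> nat by apply/eqP; rewrite eqn_leq lekr -ltnS ltn_ord.
  rewrite [X in _ + X](_ : _ = 0) ?addn0.
    have := last_ok a.
    by rewrite mem01 /last_mx (last_nth (zero_mx n)) size_tuple rk.
  by rewrite nth_default ?size_tuple // col_sum0.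
split; [apply/forallP => i; apply/forallP => a | apply/forallP => a].
  have := deg1 (widen_ord (leqnSn k) i, a).
  by rewrite degree_linear mem01.
have := deg1 (ord_max, a); rewrite degree_linear mem01 /=.
rewrite /last_mx (last_nth (zero_mx n)) size_tuple.
by move/(leq_trans _); apply; apply: leq_addr.
Qed.

(** Row 0 now receives the heads of the edges from row k - 1, whose matrix is
    the last one; for k = 1 the tail and the head of a loop are counted in the
    two terms. *)
Lemma degree_circular (hk : 0 < k) X (v : vertex (circular_graph n hk)) :
  @degree (circular_graph n hk) (arc_set X) v =
  row_sum (nth (zero_mx n) (last_mx X :: X) v.1) v.2
    + col_sum (nth (zero_mx n) X v.1) v.2.
Proof.
case: v => r a /=; rewrite /degree addnC; congr (_ + _).
  transitivity (\sum_(i < k | val r == i.+1 %% k) row_sum (tnth X i) a).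
    rewrite -sum_arc_heads; apply: eq_bigr => [[i [c d]] _] /=.
    by rewrite xpair_eqE -val_eqE.
  have lastE : last_mx X = nth (zero_mx n) X k.-1.
    by rewrite /last_mx -nth_last size_tuple.
  case: r => [[|r'] ltrk] /=; rewrite ?lastE
      -(@sum_pred1_nth _ (fun A => row_sum A a) _ (row_sum0 a));
    apply: eq_bigl => i; have := ltn_ord i => ltik.
    have [/eqP ik|nik] := boolP (i.+1 == k); first by rewrite ik modnn; lia.
    by rewrite modn_small; lia.
  have [/eqP ik|nik] := boolP (i.+1 == k); first by rewrite ik modnn; lia.
  by rewrite modn_small; lia.
rewrite -(@sum_pred1_nth _ (fun A => col_sum A a) _ (col_sum0 a)).
rewrite -sum_arc_tails.
apply: eq_bigr => [[i [c d]] _] /=.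
by rewrite xpair_eqE -val_eqE /= modn_small.
Qed.

Lemma circular_conditionE (hk : 0 < k) X :
  circular_condition X = @matching (circular_graph n hk) (arc_set X).
Proof.
apply/forallP/matching_degreeP => [chain_ok [r a] | deg1 i].
  by have /forallP/(_ a) := chain_ok r; rewrite degree_circular mem01.
apply/forallP => a; have := deg1 (i, a).
by rewrite degree_circular mem01.
Qed.

(** As 2 |M| + #unmatched is constant over matchings, a matching is maximum if
    and only if it leaves as few vertices unmatched as possible; m is this
    minimum, being a lower bound attained at M0. *)
Lemma maximizers_in_bijection (G : multigraph) (f : chain -> {set edge G})
    (cond : pred chain) (m : nat) (M0 : {set edge G}) :
  bijective f -> (forall X, #|f X| = entry_sum X) ->
  (forall X, cond X = matching (f X)) ->
  (forall M : {set edge G}, matching M -> m <= #|unmatched M|) ->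
  matching M0 -> #|unmatched M0| <= m ->
  in_bijection (maximizers cond) (matchings_leaving G m).
Proof.
move=> bij_f sizef condE lower mM0 upper.
apply: (in_bijection_preim bij_f) => X; rewrite !inE condE.
have [mX /=|//] := boolP (matching (f X)); have [g _ gK] := bij_f.
have countX := matching_count mX; have lowX := lower _ mX.
apply/eqP/forallP => [mE Y | maxX].
  apply/implyP; rewrite condE => mY; rewrite -!sizef.
  by have := matching_count mY; have := lower _ mY; lia.
have /implyP := maxX (g M0); rewrite condE -!sizef gK => /(_ mM0).
by have := matching_count mM0; lia.
Qed.

End Encoding.

(** * The linear graph *)

Section Linear.

Variables n k : nat.
Let G := linear_graph n k.

Definition vertical_matching : {set edge G} :=
  [set e : 'I_k * ('I_n * 'I_n) | ~~ odd e.1 && (e.2.1 == e.2.2)].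

Lemma vertical_matchingP : matching vertical_matching.
Proof.
apply/andP; split; apply/forall_inP => [[i [a b]]]; rewrite inE /=.
  by move=> _; rewrite /is_loop /= xpair_eqE -val_eqE /= /bump; lia.
case/andP=> oi /eqP <-; apply/forall_inP => [[j [c d]]]; rewrite inE /=.
case/andP=> oj /eqP <-; apply/implyP; apply: contra.
case/existsP=> [[r s]]; rewrite /incident /= !xpair_eqE -!val_eqE /= /bump.
by rewrite /=; lia.
Qed.

Lemma vertical_unmatched (v : vertex G) :
  v \in unmatched vertical_matching -> (v.1 == ord_max) && ~~ odd k.
Proof.
case: v => r a; rewrite inE /=; apply: contraR => full.
(* The vertical edge covering row r starts at the even one of r and r - 1. *)
have lt_even : (if odd r then r.-1 else r) < k.
  by have := ltn_ord r; move: full; rewrite -val_eqE /=; case: ifP; lia.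
apply/existsP; exists (Ordinal lt_even, (a, a)).
rewrite inE /= eqxx andbT /incident !xpair_eqE eqxx !andbT -!val_eqE /= /bump.
by case: ifP; lia.
Qed.

Lemma vertical_unmatched_card :
  #|unmatched vertical_matching| <= (if odd k then 0 else n).
Proof.
case: ifP => [ok | /negbT ek].
  rewrite leqn0 cards_eq0; apply/eqP/setP => v; rewrite [RHS]inE.
  by apply/negP => /vertical_unmatched; rewrite ok andbF.
apply: (@leq_trans #|[set (@ord_max k, a) | a : 'I_n]|).
  apply/subset_leq_card/subsetP => [[r a]].
  case/vertical_unmatched/andP=> /eqP /= -> _.
  by apply: imset_f.
by apply: leq_trans (leq_imset_card _ _) _; rewrite card_ord.
Qed.

Lemma sum_odd m : \sum_(r < m) odd r = m./2.
Proof.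
by elim: m => [|m IHm]; rewrite ?big_ord0 // big_ord_recr IHm /=; lia.
Qed.

(** For even k, the odd rows cover all edges and hold n fewer vertices than the
    even rows. *)
Lemma linear_unmatched_ge (M : {set edge G}) :
  matching M -> (if odd k then 0 else n) <= #|unmatched M|.
Proof.
case: ifP => // /negbT ek mM; pose C := [set v : vertex G | odd v.1].
have cardC : #|C| = k.+1./2 * n.
  rewrite (_ : C = setX [set r : 'I_k.+1 | odd r] setT).
    rewrite cardsX cardsT card_ord -sum_odd -sum1_card big_mkcond.
    by congr (_ * _); apply: eq_bigr => r _; rewrite inE; case: odd.
  by apply/setP => [[r a]]; rewrite !inE andbT.
have coverC (e : edge G) : ((ends e).1 \in C) || ((ends e).2 \in C).
  by case: e => [i [a b]]; rewrite !inE /= /bump /=; lia.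
have := matching_count mM; have := matching_le_cover coverC mM.
rewrite cardC card_prod !card_ord -{2}[k.+1]odd_double_half /= ek.
by rewrite mulnDl -doubleMl; lia.
Qed.

Lemma linear_in_bijection :
  in_bijection (linear_chained_perms n k)
    (matchings_leaving G (if odd k then 0 else n)).
Proof.
apply: (@maximizers_in_bijection n k G (@arc_set n k) _ _ vertical_matching).
- exact: arc_set_bij.
- exact: card_arc_set.
- exact: linear_conditionE.
- exact: linear_unmatched_ge.
- exact: vertical_matchingP.
- exact: vertical_unmatched_card.
Qed.

End Linear.

(** * The circular graph *)

Section Circular.

Variables (n k : nat) (hk : 0 < k).
Let G := circular_graph n hk.

(** Whether the edge from vertex a of row i to vertex b of the next row is
    selected.  For even k these are the vertical edges from even rows; row
    k - 1 being odd, none of them closes the circle.  For odd k, the edge from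
    row k - 1 (to row 0) is used to link column a = 2c to column a + 1, which
    leaves rows 0 to k - 2 of column a and rows 1 to k - 1 of column a + 1 to
    be covered by vertical edges: they start at even rows in even columns and
    at odd rows in odd columns.  If n is odd, the last column has no partner,
    and only its row k - 1 is missed. *)
Definition snake_arc (i a b : nat) : bool :=
  if odd k && (i.+1 == k) then ~~ odd a && (b == a.+1)
  else (a == b) && (odd i == odd k && odd a).

Definition snake_matching : {set edge G} :=
  [set e : 'I_k * ('I_n * 'I_n) | snake_arc e.1 e.2.1 e.2.2].

Lemma succ_modE i : i < k -> i.+1 %% k = if i.+1 == k then 0 else i.+1.
Proof. by case: eqP => [->|ne] ltik; rewrite ?modnn // modn_small //; lia. Qed.

Lemma incident_circular (r i : 'I_k) (s a b : 'I_n) :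
  @incident G (r, s) (i, (a, b)) =
  (r == i :> nat) && (s == a :> nat)
  || (r == (if i.+1 == k then 0 else i.+1) :> nat) && (s == b :> nat).
Proof.
by rewrite /incident /= !xpair_eqE -!val_eqE /= modn_small // succ_modE.
Qed.

Lemma snake_matchingP : matching snake_matching.
Proof.
apply/andP; split; apply/forall_inP => [[i [a b]]]; rewrite inE /= => eM.
  rewrite /is_loop /= xpair_eqE -!val_eqE /= modn_small // succ_modE //.
  by move: eM (ltn_ord i); rewrite /snake_arc; do 2 case: ifP; lia.
apply/forall_inP => [[j [c d]]]; rewrite inE /= => fM.
apply/implyP; apply: contra => /existsP[[r s]]; rewrite !incident_circular.
rewrite !xpair_eqE -!val_eqE /=.
move: eM fM (ltn_ord i) (ltn_ord j); rewrite /snake_arc.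
by do 4 case: ifP; lia.
Qed.

(** The edge covering (r, s) starts at row r if r has the parity of the selected
    rows in column s, and at the cyclically preceding row otherwise; in both
    cases it is a linking edge exactly when k is odd and the edge starts at row
    k - 1. *)
Lemma snake_unmatched (v : vertex G) :
  v \in unmatched snake_matching -> (v.1.+1 == k) && (v.2.+1 == n).
Proof.
case: v => r s; rewrite inE /=; apply: contraR => not_last.
have ltrk := ltn_ord r; have ltsn := ltn_ord s.
have covered (i : 'I_k) (a b : 'I_n) : snake_arc i a b ->
    @incident G (r, s) (i, (a, b)) ->
    [exists e in snake_matching, @incident G (r, s) e].
  by move=> arc inc; apply/existsP; exists (i, (a, b)); rewrite inE /= arc.
have [par | par] := boolP (odd r == odd k && odd s).
  have [/andP[ok rk] | inner] := boolP (odd k && (r.+1 == k)); last first.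
    apply: (covered r s s); rewrite ?incident_circular ?eqxx //.
    by rewrite /snake_arc (negPf inner) par eqxx.
  have lts1 : s.+1 < n by move: not_last; rewrite rk; lia.
  apply: (covered r s (Ordinal lts1)); rewrite ?incident_circular ?eqxx //.
  by rewrite /snake_arc ok rk eqxx andbT /=; lia.
have [r0 | rpos] := posnP r.
  have ltk1 : k.-1 < k by rewrite prednK.
  have lts1 : s.-1 < n by lia.
  (* Here k and s are odd, because r = 0 is even. *)
  apply: (covered (Ordinal ltk1) (Ordinal lts1) s).
    by rewrite /snake_arc /= prednK // eqxx; case: ifP; lia.
  by rewrite incident_circular /= prednK // r0 !eqxx orbT.
have ltr1 : r.-1 < k by lia.
apply: (covered (Ordinal ltr1) s s).
  by rewrite /snake_arc /= prednK // eqxx; case: ifP; lia.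
by rewrite incident_circular /= prednK // eqxx andbT; case: ifP; lia.
Qed.

(** At most one vertex is missed, and parity tells whether it is. *)
Lemma snake_unmatched_card :
  #|unmatched snake_matching| <= odd (n * k).
Proof.
have : #|unmatched snake_matching| <= 1.
  apply/card_le1_eqP => [[r s] [r' s']].
  move=> /snake_unmatched/andP[/= /eqP rk /eqP sn].
  move=> /snake_unmatched/andP[/= /eqP rk' /eqP sn'].
  by congr pair; apply: val_inj; apply: succn_inj; rewrite ?rk ?sn.
have := odd_unmatched snake_matchingP.
by rewrite card_prod !card_ord mulnC => <-; case: #|_| => [|[]].
Qed.

Lemma circular_in_bijection :
  in_bijection (circular_chained_perms n k)
    (matchings_leaving G (odd (n * k))).
Proof.
have cardV : #|vertex G| = k * n by rewrite card_prod !card_ord.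
apply: (@maximizers_in_bijection n k G (@arc_set n k) _ _ snake_matching).
- exact: arc_set_bij.
- exact: card_arc_set.
- exact: circular_conditionE.
- move=> M /odd_unmatched; rewrite cardV mulnC => <-.
  by case: #|_| => // m; case: odd.
- exact: snake_matchingP.
- exact: snake_unmatched_card.
Qed.

End Circular.

Theorem theorem3p10 (n k : nat) (hn : 0 < n) (hk : 0 < k) :
  (odd k ->
     in_bijection (linear_chained_perms n k)
       (perfect_matchings (linear_graph n k))) /\
  (~~ odd k ->
     in_bijection (linear_chained_perms n k)
       (matchings_leaving (linear_graph n k) n)) /\
  (~~ odd n \/ ~~ odd k ->
     in_bijection (circular_chained_perms n k)
       (perfect_matchings (circular_graph n hk))) /\
  (odd n /\ odd k ->
     in_bijection (circular_chained_perms n k)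
       (near_perfect_matchings (circular_graph n hk))).
Proof.
have lin := linear_in_bijection n k; have circ := circular_in_bijection n hk.
rewrite !perfect_matchingsE; split=> [ok|]; first by rewrite ok in lin.
split=> [/negPf ek|]; first by rewrite ek in lin.
rewrite oddM in circ.
split=> [even|[on ok]]; last by rewrite on ok in circ.
have /negPf nk : ~~ (odd n && odd k) by rewrite negb_and; apply/orP.
by rewrite nk in circ.
Qed.
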